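(* The function $\varphi$, defined on the set $\{x_n : n\in\mathbb Z\}\subset \mathbb R/\mathbb Z$ by $$\varphi(x_n)=\log \ell_{n+1}-\log \ell_n,\qquad n\in\mathbb Z,$$ extends to a continuous function $\mathbb R/\mathbb Z\to\mathbb R$ on the circle.
   Context: Let $\alpha=\sqrt5-2$ (irrational) and $r=\alpha^{1/2}$. For $x\in\mathbb R$ let $d(x)=\mathrm{dist}(x,\mathbb Z)$ denote the distance from $x$ to the nearest integer. For $n\in\mathbb Z$ let $$L_n=\sum_{j=1}^{\infty} r^{-j}\, d(\alpha^{j} n)$$ (this series converges for every $n$), and $\ell_n=e^{-L_n}$. Let $x_n=(n\alpha \bmod \mathbb Z)\in\mathbb R/\mathbb Z$; this is the orbit of $0$ under the rotation $R_\alpha(x)=x+\alpha \bmod \mathbb Z$, and the points $x_n$, $n\in\mathbb Z$, are pairwise distinct. *)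

(* Defs.v *)
From HB Require Import structures.
From mathcomp Require Import all_boot all_order all_algebra generic_quotient ring_quotient.
From mathcomp Require Import all_classical all_reals all_analysis.
From mathcomp Require Import ring lra.

Set Implicit Arguments.
Unset Strict Implicit.
Unset Printing Implicit Defensive.

Import Order.TTheory GRing.Theory Num.Theory.
Import numFieldNormedType.Exports.

Local Open Scope classical_set_scope.
Local Open Scope ring_scope.
Local Open Scope quotient_scope.

(* [Num.int_num_subdef] is the predicate underlying the qualifier [Num.int], and
   the one that carries the closure instances. *)
Definition int_subgroup (R : realType) : zmodClosed R :=
  GRing.ZmodClosed.clone R (@Num.int_num_subdef R) _.

Definition circle (R : realType) : Type :=
  quotient_topology {ideal_quot int_subgroup R}.

HB.instance Definition _ (R : realType) := Topological.on (circle R).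
HB.instance Definition _ (R : realType) := Quotient.on (circle R).

Definition to_circle (R : realType) (x : R) : circle R := \pi_(circle R) x.

Section Objects.
Variable R : realType.

Definition dist_int (x : R) : R := inf [set `|x - m%:~R| | m in [set: int]].

Definition alpha : R := Num.sqrt 5 - 2.

Definition r : R := Num.sqrt alpha.

(* [limn] is a limit only for a convergent sequence: see [is_cvg_L]. *)
Definition L (n : int) : R :=
  limn (fun N => \sum_(1 <= j < N) r ^- j * dist_int (alpha ^+ j * n%:~R)).

Definition ell (n : int) : R := expR (- L n).

Definition x_ (n : int) : circle R := to_circle (n%:~R * alpha).

End Objects.

Lemma to_circle_eq (R : realType) (x y : R) :
  to_circle x = to_circle y <-> exists m : int, x - y = m%:~R.
Proof.
have -> : (to_circle x = to_circle y) <-> (x - y \in @Num.int R).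
  rewrite (Quotient.idealrBE (int_subgroup R)); split=> [h|/eqP h//].
  exact/eqP.
by split=> [/intrP|h]; last exact/intrP.
Qed.

Lemma to_circle_continuous (R : realType) : continuous (@to_circle R).
Proof. exact: pi_continuous. Qed.

Section Convergence.
Variable R : realType.

Let has_inf_dist (x : R) : has_inf [set `|x - m%:~R| | m in [set: int]].
Proof.
split; first by exists `|x - 0%:~R|; exists 0.
by exists 0 => _ [m _ <-].
Qed.

Lemma dist_int_ge0 (x : R) : 0 <= dist_int x.
Proof.
apply: lb_le_inf; first exact: (has_inf_dist x).1.
by move=> _ [m _ <-].
Qed.

Lemma dist_int_le (x : R) (m : int) : dist_int x <= `|x - m%:~R|.
Proof. by apply: ge_inf; [exact: (has_inf_dist x).2|exists m]. Qed.

Lemma dist_int_attained (x : R) : exists m : int, dist_int x = `|x - m%:~R|.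
Proof.
have attain (k : int) :
    (forall m : int, `|x - k%:~R| <= `|x - m%:~R|) ->
    exists m : int, dist_int x = `|x - m%:~R|.
  move=> kmin; exists k; apply/eqP; rewrite eq_le dist_int_le/=.
  apply: lb_le_inf; first exact: (has_inf_dist x).1.
  by move=> _ [m _ <-].
have f1 : (Num.floor x)%:~R <= x by exact: Num.Theory.floor_le.
have f2 : x < (Num.floor x)%:~R + 1.
  by have := Num.Theory.floorD1_gt x; rewrite intrD.
set f := Num.floor x in f1 f2.
have far m : (m%:~R <= f%:~R :> R) \/ (f%:~R + 1 <= m%:~R :> R).
  have [h|] := leP m f; first by left; rewrite ler_int.
  by rewrite -lezD1 => h; right; move: h; rewrite -(ler_int R) intrD.
have [h|h] := leP (x - f%:~R) (f%:~R + 1 - x).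
  apply: (attain f) => m; rewrite (ger0_norm (_ : 0 <= x - f%:~R)) ?subr_ge0//.
  by have [hm|hm] := far m; have := ler_norm (x - m%:~R);
    have := ler_norm (m%:~R - x); rewrite (distrC m%:~R x); lra.
apply: (attain (f + 1)) => m; rewrite distrC intrD ger0_norm; last lra.
by have [hm|hm] := far m; have := ler_norm (x - m%:~R);
  have := ler_norm (m%:~R - x); rewrite (distrC m%:~R x); lra.
Qed.

Lemma alpha_gt0 : 0 < alpha R.
Proof.
rewrite /alpha subr_gt0 -(@ltr_pXn2r _ 2)// ?nnegrE ?sqrtr_ge0//.
by rewrite sqr_sqrtr; lra.
Qed.

Lemma alpha_lt1 : alpha R < 1.
Proof.
rewrite /alpha ltrBlDr -(@ltr_pXn2r _ 2)// ?nnegrE ?sqrtr_ge0//.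
by rewrite sqr_sqrtr; lra.
Qed.

Lemma r_gt0 : 0 < r R. Proof. by rewrite sqrtr_gt0 alpha_gt0. Qed.

Lemma r_lt1 : r R < 1.
Proof. by rewrite -(@sqrtr1 R) ltr_sqrt ?alpha_lt1. Qed.

Lemma is_cvg_L (n : int) :
  cvgn (fun N =>
    \sum_(1 <= j < N) r R ^- j * dist_int (alpha R ^+ j * n%:~R)).
Proof.
have r0 := r_gt0; have r1 := r_lt1.
have term_ge0 j : 0 <= r R ^- j * dist_int (alpha R ^+ j * n%:~R).
  by rewrite mulr_ge0 ?dist_int_ge0// invr_ge0 exprn_ge0// ltW.
have term_le j :
    r R ^- j * dist_int (alpha R ^+ j * n%:~R) <= `|n%:~R| * r R ^+ j.
  have := dist_int_le (alpha R ^+ j * n%:~R) 0.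
  rewrite subr0 normrM ger0_norm ?exprn_ge0 ?(ltW alpha_gt0)// => h.
  rewrite mulrC ler_pdivrMr ?exprn_gt0//; apply: le_trans h _.
  by rewrite -mulrA -exprMn -expr2 sqr_sqrtr ?(ltW alpha_gt0)// mulrC.
apply: nondecreasing_is_cvgn.
  apply/nondecreasing_seqP => -[|N]; first by rewrite !big_geq.
  by rewrite [leRHS]big_nat_recr//= lerDl.
exists (`|n%:~R| * (1 - r R)^-1) => _ [N _ <-].
apply: (@le_trans _ _ (\sum_(0 <= j < N) `|n%:~R| * r R ^+ j)).
  case: N => [|N]; first by rewrite !big_geq.
  rewrite [leRHS]big_nat_recl// -[leLHS]add0r.
  rewrite big_add1/=; apply: lerD; last by apply: ler_sum.
  by rewrite mulr_ge0// exprn_ge0// ltW.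
rewrite -mulr_sumr ler_wpM2l// big_mkord -[leRHS]mul1r ler_pdivlMr ?subr_gt0//.
have -> : (\sum_(i < N) r R ^+ i) * (1 - r R) = 1 - r R ^+ N.
  by rewrite mulrC -[X in X - _ ^+ _](expr1n R N) subrXX; congr (_ * _);
    apply: eq_bigr => i _; rewrite expr1n mul1r.
by rewrite lerBlDr lerDl exprn_ge0// ltW.
Qed.

End Convergence.

Section Orbit.
Variable R : realType.

Lemma alpha_irrational (k d : int) : d != 0 -> k%:~R != d%:~R * alpha R.
Proof.
move=> d0; apply/negP => /eqP kd.
have sq : (k + 2 * d) ^+ 2 = 5 * d ^+ 2.
  apply: (@intr_inj R); rewrite !(intrM, intrD, expr2) kd /alpha.
  have s5 : Num.sqrt (5 : R) * Num.sqrt 5 = 5 by rewrite -expr2 sqr_sqrtr.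
  rewrite [LHS](_ : _ = Num.sqrt 5 * Num.sqrt 5 * (d%:~R * d%:~R)); last by ring.
  by rewrite s5; ring.
have : (`|(k + 2 * d)%R| ^ 2 = 5 * `|d| ^ 2)%N.
  by rewrite -!abszX sq abszM.
move=> /(congr1 (logn 5)); rewrite lognM ?expn_gt0 ?absz_gt0 ?d0// !lognX.
by move=> /(congr1 odd); rewrite oddD !oddM.
Qed.

Lemma x_inj : injective (x_ R).
Proof.
move=> n m /to_circle_eq[k]; rewrite -mulrBl -intrB => /esym/eqP nmk.
apply/eqP; rewrite -subr_eq0; apply: contraTT nmk.
exact: alpha_irrational.
Qed.

End Orbit.

(* Main.v *)
Require Import Defs.
From mathcomp Require Import all_boot all_order all_algebra.
From mathcomp Require Import generic_quotient.
From mathcomp Require Import all_classical all_reals all_analysis.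
From mathcomp Require Import ring lra.

Import Order.TTheory GRing.Theory Num.Theory.
Import numFieldNormedType.Exports.

Local Open Scope classical_set_scope.
Local Open Scope ring_scope.

(** Since [alpha ^+ 2 = 1 - 4 * alpha], every power of [alpha] is an integer
    combination [alpha ^+ j = a j * alpha + b j] ([alphaX_int_comb]). Modulo
    the integers, [alpha ^+ j * n] is therefore [a j] times the orbit point
    [n * alpha] ([dist_int_alphaX]), so that
    [ln (ell (n + 1)) - ln (ell n) = L n - L (n + 1)] is the value at
    [x = n * alpha] of the series, over [j >= 1], of the functions
    [r ^- j * (dist_int (a j * x) - dist_int (a j * x + alpha ^+ j))].
    Each of these is continuous in the real variable [x], and 1-periodic
    because [a j] is an integer. As [dist_int] is 1-Lipschitz, the [j]-th one is
    bounded by [r ^- j * alpha ^+ j = r ^+ j]: the factors [a j] grow, but only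
    the shift [alpha ^+ j] enters the bound. Hence the series satisfies the
    M-test ([continuous_series]), its sum is a continuous periodic function on
    the line, and it descends to the circle ([circle_lift]). *)

(** The bound does not involve the terms [u j], hence is uniform when these are
    the values of functions dominated by [M]. *)
Lemma series_tail_le (R : realType) (u M : R^nat) (N : nat) :
  (forall j, `|u j| <= M j) -> cvgn (series M) ->
  `|limn (series u) - series u N| <= limn (series M) - series M N.
Proof.
move=> uM cM.
have M0 j : 0 <= M j by exact: le_trans (uM j).
have cu : cvgn (series u).
  by apply: normed_cvg; apply: series_le_cvg uM cM => // j.
have cd : `|series u n - series u N| @[n --> \oo] -->
    `|limn (series u) - series u N|.
  by apply: cvg_norm; apply: cvgB => //; exact: cvg_cst.
rewrite -(cvg_lim _ cd)//; apply: limr_le; first by apply/cvg_ex; eexists; exact: cd.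
near=> n.
have Nn : (N <= n)%N by near: n; exact: nbhs_infty_ge.
have -> : series u n - series u N = \sum_(N <= k < n) u k.
  exact: sub_series_geq.
apply: (le_trans (ler_norm_sum _ _ _)).
apply: (@le_trans _ _ (series M n - series M N)).
  have -> : series M n - series M N = \sum_(N <= k < n) M k.
    exact: sub_series_geq.
  exact: ler_sum.
by rewrite lerD2r; apply: nondecreasing_cvgn_le => //; exact: nondecreasing_series.
Unshelve. all: by end_near. Qed.

Lemma continuous_series (R : realType) (T : topologicalType)
    (g : nat -> T -> R) (M : R^nat) :
  (forall j, continuous (g j)) -> (forall j x, `|g j x| <= M j) ->
  cvgn (series M) ->
  continuous (fun x => limn (series (g ^~ x))).
Proof.
move=> cg gM cM x; apply/cvgrPdist_lt => e e0.
have e3 : 0 < e / 3 by rewrite divr_gt0.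
have [N _ /(_ N (leqnn N)) tailN] :
    \forall n \near \oo, `|limn (series M) - series M n| < e / 3.
  exact: (cvgrPdist_lt _ _).1 cM _ e3.
have tail y : `|limn (series (g ^~ y)) - series (g ^~ y) N| < e / 3.
  apply: le_lt_trans tailN.
  exact: le_trans (series_tail_le _ _ _ N (fun j => gM j y) cM) (ler_norm _).
have cS : {for x, continuous (fun y => series (g ^~ y) N)}.
  by apply: continuous_big => [|i _]; [exact: add_continuous|exact: cg].
near=> y.
have hx := tail x; have hy := tail y.
have hxy : `|series (g ^~ x) N - series (g ^~ y) N| < e / 3.
  near: y; exact: (cvgrPdist_lt _ _).1 cS _ e3.
move: hx hy hxy; rewrite !ltr_norml; lra.
Unshelve. all: by end_near. Qed.

(** An integer nearest to one of the two points is a competitor for the other. *)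
Lemma dist_int_lipschitz (R : realType) (x y : R) :
  `|dist_int x - dist_int y| <= `|x - y|.
Proof.
have half (s t : R) : dist_int s <= dist_int t + `|s - t|.
  have [m ->] := dist_int_attained t.
  apply: le_trans (dist_int_le s m) _.
  by rewrite (_ : s - m%:~R = (t - m%:~R) + (s - t)) ?ler_normD//; ring.
rewrite ler_norml lerBlDl half andbT.
by have := half y x; rewrite distrC; lra.
Qed.

Lemma dist_intDz (R : realType) (x : R) (m : int) :
  dist_int (x + m%:~R) = dist_int x.
Proof.
have half (s : R) (k : int) : dist_int (s + k%:~R) <= dist_int s.
  have [l ->] := dist_int_attained s.
  apply: le_trans (dist_int_le _ (l + k)) _.
  by rewrite intrD (_ : s + _ - _ = s - l%:~R)//; ring.
apply/eqP; rewrite eq_le half/=.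
by have := half (x + m%:~R) (- m); rewrite intrN addrK.
Qed.

Lemma continuous_dist_int (R : realType) : continuous (@dist_int R).
Proof.
move=> x; apply/cvgrPdist_lt => e e0; near=> y.
apply: le_lt_trans (dist_int_lipschitz R x y) _.
near: y; exact: cvgr_dist_lt.
Unshelve. all: by end_near. Qed.

Lemma alpha_sqr (R : realType) : alpha R ^+ 2 = 1 - 4 * alpha R.
Proof.
have s5 : Num.sqrt (5 : R) ^+ 2 = 5 by rewrite sqr_sqrtr.
rewrite /alpha (_ : (_ - 2) ^+ 2 = Num.sqrt 5 ^+ 2 - 4 * Num.sqrt 5 + 4); last ring.
by rewrite s5; ring.
Qed.

(** The integer combinations of [alpha] and [1] are stable under multiplication
    by [alpha], which is a quadratic algebraic integer. *)
Lemma alphaX_int_comb (R : realType) (j : nat) :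
  exists a b : int, alpha R ^+ j = a%:~R * alpha R + b%:~R.
Proof.
elim: j => [|j [a [b jE]]]; first by exists 0, 1; rewrite expr0 mul0r add0r.
exists (b - 4 * a), a; rewrite exprSr jE intrB intrM.
by rewrite mulrDl -mulrA -expr2 alpha_sqr; ring.
Qed.

(** The terms of [L n] depend on [n] only through the point [n * alpha] modulo
    the integers. With [t = alpha ^+ j], the same holds for those of
    [L (n + 1)]. *)
Lemma dist_int_alphaX (R : realType) (j : nat) (a b n : int) (t : R) :
  alpha R ^+ j = a%:~R * alpha R + b%:~R ->
  dist_int (alpha R ^+ j * n%:~R + t) = dist_int (a%:~R * (n%:~R * alpha R) + t).
Proof.
move=> ->; rewrite -[RHS](dist_intDz _ _ (b * n)); congr dist_int.
by rewrite intrM; ring.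
Qed.

Lemma circle_lift (R : realType) (f : R -> R) :
  continuous f -> (forall x (m : int), f (x + m%:~R) = f x) ->
  exists phi : circle R -> R,
    continuous phi /\ forall x, phi (to_circle x) = f x.
Proof.
move=> cf fper.
have fE x y : to_circle x = to_circle y -> f x = f y.
  by move=> /to_circle_eq[m /eqP]; rewrite subr_eq addrC => /eqP ->.
exists (f \o repr); split.
  by apply: repr_comp_continuous => // x y /eqP /fE ->.
by move=> x; apply: fE; exact: reprK.
Qed.

Lemma ln_ell (R : realType) (n : int) : ln (ell R n) = - L R n.
Proof. exact: expRK. Qed.

Theorem proposition1p5 (R : realType) :
  exists phi : circle R -> R,
    continuous phi /\
    forall n : int, phi (x_ R n) = ln (ell R (n + 1)) - ln (ell R n).
Proof.
have [r0 r1] := (r_gt0 R, r_lt1 R).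
have r_sqr : r R ^+ 2 = alpha R by rewrite sqr_sqrtr// ltW// alpha_gt0.
have [a aP] := choice (alphaX_int_comb R).
(* The sums defining [L] start at 1, whereas [series] starts at 0. *)
pose g j x : R := r R ^- j.+1 *
  (dist_int ((a j.+1)%:~R * x) - dist_int ((a j.+1)%:~R * x + alpha R ^+ j.+1)).
have cg j : continuous (g j).
  have cd (h : R -> R) : continuous h -> continuous (@dist_int R \o h).
    by move=> ch x; apply: continuous_comp; [exact: ch|exact: continuous_dist_int].
  have ca : continuous (fun x : R => (a j.+1)%:~R * x).
    by move=> x; apply: cvgMl_tmp; exact: cvg_id.
  move=> x; apply: cvgMl_tmp; apply: cvgB; first exact: cd.
  apply: (cd (fun y => (a j.+1)%:~R * y + alpha R ^+ j.+1)) => y.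
  by apply: cvgD; [exact: ca|exact: cvg_cst].
have gM j x : `|g j x| <= geometric (r R) (r R) j.
  rewrite normrM ger0_norm ?invr_ge0 ?exprn_ge0 ?(ltW r0)//.
  rewrite mulrC ler_pdivrMr ?exprn_gt0// /geometric/= -exprS -exprMn -expr2 r_sqr.
  apply: le_trans (dist_int_lipschitz _ _ _) _.
  by rewrite opprD addrA subrr sub0r normrN ger0_norm// exprn_ge0// ltW// alpha_gt0.
have cM : cvgn (series (geometric (r R) (r R))).
  by apply: is_cvg_geometric_series; rewrite ger0_norm// ltW.
have gper (y : R) (m : int) : g ^~ (y + m%:~R) = g ^~ y.
  apply/funext => j; rewrite /g/= (mulrDr (a _)%:~R) -intrM dist_intDz.
  by rewrite addrAC dist_intDz.
have [phi [cphi phiE]] := @circle_lift R _ (continuous_series _ _ _ _ cg gM cM)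
  (fun x m => congr1 (fun u => limn (series u)) (gper x m)).
exists phi; split=> // n; rewrite phiE !ln_ell opprK addrC.
(* [L n] and [L (n + 1)] are separately no continuous functions of the orbit
   point: the two series have to be subtracted term by term. *)
rewrite -limB; [|exact: is_cvg_L..].
set D := (X in _ = limn X).
have gE : series (g ^~ (n%:~R * alpha R)) = [sequence D N.+1]_N.
  apply/funext => N; rewrite /series/= /D !fctE !big_add1/= -sumrB.
  apply: eq_bigr => j _; rewrite /g -mulrBr; have [b jE] := aP j.+1.
  rewrite -(dist_int_alphaX _ _ _ _ _ _ jE).
  rewrite -[(a _)%:~R * _]addr0 -(dist_int_alphaX _ _ _ _ _ _ jE).
  by rewrite addr0 intrD mulr1z (mulrDr (alpha R ^+ _)) mulr1.
apply: cvg_lim => //; rewrite gE cvg_shiftS.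
by apply: is_cvgB; exact: is_cvg_L.
Qed.
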